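(* Consider a system subject to the cumulative shock model, with lifetime $S$, in which the shock process $\{M(t)\}_{t\ge0}$ is a geometric counting process $G_\mu$ with parameter $\mu>0$, and the damage sizes $W_1,W_2,\dots$ are i.i.d. subordinated Poisson random variables distributed as $N^f(1)$, with Bernstein function $f$ and Poisson intensity $\lambda>0$, independent of $\{M(t)\}_{t\ge0}$. Let the positive integer $T$ be the threshold of the maximum damage the system can tolerate. Then for $t\ge0$ the reliability function of $S$ is $$\mathbb{P}(S>t)=\sum_{k=0}^{T-1}\frac{(-1)^k}{k!}\,\frac{d^k}{du^k}\left(\frac{1}{1+\mu t(1-e^{-f(\lambda u)})}\right)\Bigg|_{u=1}.$$
   Context: $\{D^f(t)\}_{t\ge0}$ is a Lévy subordinator (non-decreasing Lévy process) with $\mathbb{E}[e^{-sD^f(t)}]=e^{-tf(s)}$, where $f(s)=bs+\int_0^\infty(1-e^{-sx})\,\nu(dx)$, $b\ge0$, is a Bernstein function, and $\nu$ is a Lévy measure on the positive half-line with $\int_0^\infty (x\wedge 1)\,\nu(dx)<\infty$ and infinite total mass. $N$ is a homogeneous Poisson process with intensity $\lambda>0$ independent of $D^f$, and $N^f(t)=N(D^f(t))$. The geometric counting process $\{G_\mu(t)\}_{t\ge0}$ is the mixed Poisson process whose random rate is exponentially distributed with mean $\mu>0$, so $\mathbb{P}[G_\mu(t)=k]=\frac{1}{1+\mu t}\left(\frac{\mu t}{1+\mu t}\right)^k$, $k=0,1,2,\dots$. Cumulative shock model: $M(t)$ counts the shocks in $(0,t]$; the $i$th shock causes damage $W_i$;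 shocks are the only cause of failure. The total damage at time $t$ is $Z(t)=\sum_{i=1}^{M(t)}W_i$ (empty sum $=0$), and the system is working at time $t$ exactly when the total damage is below $T$, i.e. $\mathbb{P}(S>t)=\mathbb{P}(Z(t)<T)$. *)

(* Defs.v *)
From HB Require Import structures.
From mathcomp Require Import all_boot all_order all_algebra.
From mathcomp Require Import all_classical all_reals all_analysis.

Set Implicit Arguments.
Unset Strict Implicit.
Unset Printing Implicit Defensive.

Import Order.TTheory GRing.Theory Num.Theory.
Import numFieldNormedType.Exports.

Local Open Scope classical_set_scope.
Local Open Scope ring_scope.

(* Continuous-time processes are families indexed by all of [R]; only the
   indices [t >= 0] are ever constrained. Path properties are required for
   every sample point, so that [N (D t w) w] below is a random variable. *)

Section independence.
Context {d : measure_display} {Omega : measurableType d} {R : realType}.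
Variable P : probability Omega R.

Definition independent_classes {I : eqType} (F : I -> set (set Omega)) : Prop :=
  forall (J : seq I) (A : I -> set Omega), uniq J ->
    (forall i, i \in J -> F i (A i)) ->
    P (\bigcap_(i in [set` J]) A i) = (\prod_(i <- J) P (A i))%E.

Definition independent_RVs {d' : measure_display} {E : measurableType d'}
    {I : eqType} (X : I -> Omega -> E) : Prop :=
  independent_classes (fun i => preimage_set_system setT (X i) measurable).

Definition process_sigma {d' : measure_display} {E : measurableType d'}
    {I : Type} (D : set I) (X : I -> {RV P >-> E}) : set (set Omega) :=
  <<s \bigcup_(i in D) preimage_set_system setT (X i) measurable >>.

Definition independent_pair (F G : set (set Omega)) : Prop :=
  forall A B, F A -> G B -> P (A `&` B) = (P A * P B)%E.

End independence.

Definition same_law {d1 d2 d' : measure_display} {Omega1 : measurableType d1}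
    {Omega2 : measurableType d2} {E : measurableType d'} {R : realType}
    (P1 : probability Omega1 R) (X1 : Omega1 -> E)
    (P2 : probability Omega2 R) (X2 : Omega2 -> E) : Prop :=
  forall A : set E, measurable A ->
    pushforward P1 X1 A = pushforward P2 X2 A.

Section processes.
Context {d : measure_display} {Omega : measurableType d} {R : realType}.
Variable P : probability Omega R.

Definition nonneg_times : set R := [set t | 0 <= t].

Definition independent_increments (X : R -> Omega -> R) : Prop :=
  forall t : nat -> R, 0 <= t 0%N -> nondecreasing_seq t ->
    independent_RVs P (fun (i : nat) w => X (t i.+1) w - X (t i) w).

Definition stationary_increments (X : R -> Omega -> R) : Prop :=
  forall s t, 0 <= s -> s <= t ->
    same_law P (fun w => X t w - X s w) P (X (t - s)).

Definition levy_process (X : R -> {RV P >-> R}) : Prop :=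
  [/\ forall w, X 0 w = 0,
      independent_increments X,
      stationary_increments X,
      forall w t, 0 <= t -> X s w @[s --> t^'+] --> X t w &
      forall w t, 0 < t -> cvg (X s w @[s --> t^'-])].

Definition levy_subordinator (X : R -> {RV P >-> R}) : Prop :=
  levy_process X /\
  forall w s t, 0 <= s -> s <= t -> X s w <= X t w.

Definition has_laplace_exponent (X : R -> {RV P >-> R}) (f : R -> R) : Prop :=
  forall s t, 0 <= s -> 0 <= t ->
    ('E_P[fun w => expR (- s * X t w)] = (expR (- t * f s))%:E)%E.

Definition counting_process (N : R -> {RV P >-> nat}) : Prop :=
  [/\ forall w, N 0 w = 0%N,
      forall w s t, 0 <= s -> s <= t -> (N s w <= N t w)%N &
      forall w t, 0 <= t -> N s w @[s --> t^'+] --> N t w].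

(* [poisson_pmf] is meaningful only at positive parameters, hence [s < t]. *)
Definition poisson_process (lambda : R) (N : R -> {RV P >-> nat}) : Prop :=
  [/\ counting_process N,
      independent_increments (fun t w => (N t w)%:R) &
      forall s t k, 0 <= s -> s < t ->
        P [set w | N t w = (N s w + k)%N] =
          (poisson_pmf (lambda * (t - s)) k)%:E].

(* Conditionally on [Lambda], the process [M] is a homogeneous Poisson process
   with intensity [Lambda], expressed on the finite-dimensional distributions
   of the increments. Sample points with [Lambda w <= 0], where [poisson_pmf]
   takes a default value, are negligible for the laws of interest. *)
Definition mixed_poisson_process (Lambda : {RV P >-> R})
    (M : R -> {RV P >-> nat}) : Prop :=
  counting_process M /\
  forall (B : set R) (n : nat) (t : nat -> R) (k : nat -> nat),
    measurable B -> 0 <= t 0%N -> increasing_seq t ->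
    P (Lambda @^-1` B `&`
       \bigcap_(i in `I_n) [set w | M (t i.+1) w = (M (t i) w + k i)%N]) =
    (\int[P]_(w in Lambda @^-1` B)
       (\prod_(i < n) poisson_pmf (Lambda w * (t i.+1 - t i)) (k i))%:E)%E.

(* An exponential law with mean [mu] has rate [mu^-1]. *)
Definition geometric_counting_process (mu : R) (M : R -> {RV P >-> nat})
    : Prop :=
  exists Lambda : {RV P >-> R},
    (forall A : set R, measurable A ->
       distribution P Lambda A = exponential_prob mu^-1 A) /\
    mixed_poisson_process Lambda M.

Definition subordinate (N : R -> {RV P >-> nat}) (D : R -> {RV P >-> R})
    (t : R) (w : Omega) : nat := N (D t w) w.

(* [W i] is the damage caused by the [i.+1]-th shock. *)
Definition total_damage (M : R -> {RV P >-> nat}) (W : nat -> {RV P >-> nat})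
    (t : R) (w : Omega) : nat := (\sum_(i < M t w) W i w)%N.

(* The lifetime takes the value [+oo] when the damage never reaches [T]. *)
Definition cumulative_shock_lifetime (M : R -> {RV P >-> nat})
    (W : nat -> {RV P >-> nat}) (T : nat) (S : Omega -> \bar R) : Prop :=
  forall w t, 0 <= t ->
    (t%:E < S w)%E <-> (total_damage M W t w < T)%N.

End processes.

(* A measure on the positive half-line is represented by a Borel measure on
   [R] of which only the restriction to [`]0, +oo[] is ever used. *)
Definition positive_levy_measure {R : realType}
    (nu : {measure set R -> \bar R}) : Prop :=
  (\int[nu]_(x in `]0%R, +oo[) (Num.min x 1)%:E < +oo)%E.

(* [f] is unconstrained on negative arguments, where the integral may
   diverge. *)
Definition bernstein_function {R : realType} (b : R)
    (nu : {measure set R -> \bar R}) (f : R -> R) : Prop :=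
  [/\ 0 <= b, positive_levy_measure nu &
      forall s, 0 <= s ->
        f s = b * s + \int[nu]_(x in `]0, +oo[) (1 - expR (- s * x))].

(* Main.v *)
(* With x = 1 - u, the function u |-> exp (- f (lambda u)) is the probability
   generating function Q(x) of the damages: conditionally on D(1), a damage is
   Poisson with rate lambda D(1), and a Poisson mixture has generating function
   E exp (- (1 - x) lambda D(1)).  The total damage at time t is a sum of a
   geometric number of independent damages, so its probabilities z_n satisfy
   the renewal equation (1 + mu t) z = delta_0 + mu t (q * z).  Hence its
   generating function is 1 / (1 + mu t (1 - Q(x))), and its coefficients z_k
   are recovered as (-1)^k / k! times the derivatives in u at 1. *)
Require Import Defs.
From HB Require Import structures.
From mathcomp Require Import all_boot all_order all_algebra.
From mathcomp Require Import all_classical all_reals all_analysis.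
From mathcomp Require Import measurable_realfun ring lra zify.

Set Implicit Arguments.
Unset Strict Implicit.
Unset Printing Implicit Defensive.

Import Order.TTheory GRing.Theory Num.Theory.
Import numFieldNormedType.Exports.

Local Open Scope classical_set_scope.
Local Open Scope ring_scope.

(** * Power series on the open unit disc *)

Section power_series.
Context {R : realType}.
Implicit Types (a b c : R^nat) (x r s : R).

(** Radius of convergence at least 1, expressed by bounds rather than by convergence, since bounds
    pass easily to derived coefficients. *)
Definition subgeometric c : Prop :=
  forall r, 0 <= r -> r < 1 -> exists C, forall n, `|c n| * r ^+ n <= C.

Lemma bounded_subgeometric c K : (forall n, `|c n| <= K) -> subgeometric c.
Proof.
move=> cK r r0 r1; exists K => n; rewrite -[leRHS]mulr1.
by apply: ler_pM => //; [exact: exprn_ge0|exact: exprn_ile1 (ltW r1)].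
Qed.

(** For a radius [r] strictly between |x| and 1, the terms are dominated by a geometric series of
    ratio |x| / r. *)
Lemma is_cvg_pseries_subgeometric c x :
  subgeometric c -> `|x| < 1 -> cvgn (pseries c x).
Proof.
move=> cb x1; pose r := (1 + `|x|) / 2.
have xr : `|x| < r by rewrite /r; lra.
have r1 : r < 1 by rewrite /r; lra.
have r0 : 0 < r by rewrite (le_lt_trans _ xr).
have [C cC] := cb r (ltW r0) r1.
have C0 : 0 <= C.
  by apply: le_trans (cC 0%N); rewrite mulr_ge0 ?exprn_ge0// ltW.
rewrite /pseries; apply: normed_cvg; apply: (@series_le_cvg _ _ (geometric C (`|x| / r))).
- by move=> n /=.
- by move=> n /=; apply: mulr_ge0 => //; rewrite exprn_ge0// divr_ge0// ltW.
- move=> n /=; rewrite normrM normrX expr_div_n mulrC [leRHS]mulrCA.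
  by rewrite ler_wpM2l ?exprn_ge0// ler_pdivlMr ?exprn_gt0.
- apply: is_cvg_geometric_series.
  by rewrite ger0_norm ?divr_ge0 ?(ltW r0)// ltr_pdivrMr// mul1r.
Qed.

(** Absorbs the factor n+1 created by differentiation into a slightly larger radius; it holds
    because r^(n+1) - s^(n+1) is r - s times n+1 terms, each at least s^n. *)
Lemma ler_natXB r s n : 0 <= s -> s <= r ->
  n.+1%:R * s ^+ n * (r - s) <= r ^+ n.+1.
Proof.
move=> s0 sr; have r0 : 0 <= r := le_trans s0 sr.
elim: n => [|n IH]; first by rewrite expr0 expr1; lra.
have h1 := ler_wpM2l s0 IH.
have h2 : s ^+ n.+1 * (r - s) <= r ^+ n.+1 * (r - s).
  by apply: ler_wpM2r; [rewrite subr_ge0|exact: lerXn2r].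
rewrite -natr1 mulrDl mul1r mulrDl (exprS r n.+1).
have -> : n.+1%:R * s ^+ n.+1 * (r - s) = s * (n.+1%:R * s ^+ n * (r - s)).
  by rewrite exprS; ring.
by apply: le_trans (lerD h1 h2) _; rewrite le_eqVlt; apply/orP; left; apply/eqP; ring.
Qed.

Lemma subgeometric_pseries_diffs c :
  subgeometric c -> subgeometric (pseries_diffs c).
Proof.
move=> cb s s0 s1; pose r := (1 + s) / 2.
have sr : s < r by rewrite /r; lra.
have r1 : r < 1 by rewrite /r; lra.
have r0 : 0 < r by rewrite (le_lt_trans s0 sr).
have [C cC] := cb r (ltW r0) r1.
exists (C / (r - s)) => n; rewrite ler_pdivlMr ?subr_gt0//.
apply: le_trans (cC n.+1); rewrite /pseries_diffs normrM normr_nat.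
rewrite (mulrC n.+1%:R) -!mulrA ler_wpM2l// mulrA.
exact: ler_natXB (ltW sr).
Qed.

Lemma subgeometric_iter_diffs c k :
  subgeometric c -> subgeometric (iter k (@pseries_diffs R) c).
Proof. by move=> cb; elim: k => // k; exact: subgeometric_pseries_diffs. Qed.

Lemma is_derive_pseries c x : subgeometric c -> `|x| < 1 ->
  is_derive x 1 (fun y => limn (pseries c y)) (limn (pseries (pseries_diffs c) x)).
Proof.
move=> cb x1; pose r := (1 + `|x|) / 2.
have r0 : 0 <= r by rewrite /r divr_ge0// addr_ge0.
have xr : `|x| < `|r| by rewrite (ger0_norm r0) /r; lra.
have r1 : `|r| < 1 by rewrite (ger0_norm r0) /r; lra.
by apply: (@pseries_snd_diffs _ _ r) => //; apply: is_cvg_pseries_subgeometric;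
  do ?apply: subgeometric_pseries_diffs.
Qed.

(** The factor (m+k)!/m! produced by k differentiations, multiplied through by m! to avoid a
    division. *)
Lemma iter_pseries_diffs0 c k m :
  iter k (@pseries_diffs R) c m * m`!%:R = (m + k)`!%:R * c (m + k)%N.
Proof.
elim: k m => [|k IH] m; first by rewrite addn0 mulrC.
by rewrite iterS /pseries_diffs mulrAC mulrC mulrC -natrM mulrC -factS IH addSnnS.
Qed.

Lemma limn_pseries0 c : limn (pseries c 0) = c 0%N.
Proof.
(* The partial sum of index 0 is empty; from index 1 on they all equal [c 0]. *)
apply: cvg_lim => //; rewrite -(cvg_shiftn 1).
apply: cvg_near_cst; apply: nearW => n /=.
rewrite /pseries /series /= addn1 big_nat_recl// expr0 mulr1 big1 ?addr0//.
by move=> i _; rewrite expr0n mulr0.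
Qed.

(** The formula covers the whole disc because the induction differentiates it and so needs it near
    each point. Every derivative through [1 - u] brings a factor -1. *)
Lemma derive1n_pseries c (g : R -> R) k : subgeometric c ->
  (forall u, `|1 - u| < 1 -> g u = limn (pseries c (1 - u))) ->
  forall u, `|1 - u| < 1 ->
    derive1n k g u = (-1) ^+ k * limn (pseries (iter k (@pseries_diffs R) c) (1 - u)).
Proof.
move=> cb gE; elim: k => [|k IH] u u1; first by rewrite derive1n0 mul1r gE.
rewrite derive1nS derive1E.
have near1 : \forall v \near u, `|1 - v| < 1.
  have : (fun v : R => `|1 - v|) @ u --> `|1 - u|.
    by apply: cvg_norm; apply: cvgB; [exact: cvg_cst|exact: cvg_id].
  by move/cvgr_lt; apply.
pose h (v : R) := (-1) ^+ k * limn (pseries (iter k (@pseries_diffs R) c) (1 - v)).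
have nearE : \near u, derive1n k g u = h u.
  by apply: filterS near1 => v; exact: IH.
rewrite (near_eq_derive _ nearE).
set G := fun y => limn (pseries (iter k (@pseries_diffs R) c) y).
have dG := is_derive_pseries (subgeometric_iter_diffs k cb) u1.
have dB : is_derive u 1 (fun v : R => 1 - v) (- 1).
  have := @is_deriveB _ _ _ (cst (1 : R)) id u 1 0 1
    (is_derive_cst _ _ _) (is_derive_id _ _).
  by rewrite sub0r.
have dGB := @is_derive1_comp _ G (fun v : R => 1 - v) _ _ _ dG dB.
have := @is_deriveZ _ _ _ _ ((-1) ^+ k) _ _ _ dGB.
by move=> /@derive_val ->; rewrite mulrN1 scalerN exprS mulN1r mulNr.
Qed.

(** At u = 1 the differentiated series is evaluated at 0, where only its constant term k! c_k
    survives. *)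
Lemma derive1n_pseries_coef c (g : R -> R) k : subgeometric c ->
  (forall u, `|1 - u| < 1 -> pseries c (1 - u) @ \oo --> g u) ->
  derive1n k g 1 = (-1) ^+ k * k`!%:R * c k.
Proof.
move=> cb gE; rewrite (@derive1n_pseries c)//.
- rewrite subrr limn_pseries0 -mulrA; congr (_ * _).
  by have := iter_pseries_diffs0 c k 0; rewrite mulr1 add0n.
- by move=> u u1; apply/esym/cvg_lim => //; exact: gE.
- by rewrite subrr normr0.
Qed.

(** Both coefficients of order k are read off the same k-th derivative. *)
Lemma pseries_inj a b : subgeometric a -> subgeometric b ->
  (forall x, `|x| < 1 -> limn (pseries a x) = limn (pseries b x)) -> a = b.
Proof.
move=> sa sb ab; apply/funext => k.
pose g u := limn (pseries a (1 - u)).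
have ga : derive1n k g 1 = (-1) ^+ k * k`!%:R * a k.
  by apply: derive1n_pseries_coef => // u u1; exact: is_cvg_pseries_subgeometric.
have gb : derive1n k g 1 = (-1) ^+ k * k`!%:R * b k.
  apply: derive1n_pseries_coef => // u u1; rewrite /g ab//.
  exact: is_cvg_pseries_subgeometric.
move: ga; rewrite gb => /esym; apply: mulfI.
by rewrite mulf_neq0 ?signr_eq0// pnatr_eq0 -lt0n fact_gt0.
Qed.

(** Cauchy product; for probability weights, the law of a sum of two independent variables. *)
Definition conv a b n := \sum_(i < n.+1) a i * b (n - i)%N.

(** These are the terms of the twice differentiated geometric series, which converges. *)
Lemma cvg_sqr_geometric x : `|x| < 1 ->
  (fun n => n.+1%:R * n.+2%:R * `|x| ^+ n) @ \oo --> (0 : R).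
Proof.
move=> x1; have s1 : subgeometric (fun=> 1).
  by apply: (@bounded_subgeometric _ 1) => n; rewrite normr1.
have /= := @cvg_series_cvg_0 _ _ _ (is_cvg_pseries_subgeometric
  (subgeometric_iter_diffs 2 s1) (_ : `| `|x| | < 1)).
rewrite normr_id => /(_ x1); apply: cvg_trans; apply: near_eq_cvg.
by apply: nearW => n; rewrite /pseries_diffs mulr1.
Qed.

(** Partial sums are values of truncated polynomials [p] and [q]. The coefficients of [p * q] below
    N are those of [conv a b], so the product of the partial sums differs from that of [conv a b]
    only by the coefficients from N to 2N - 1. *)
Lemma cvg_pseries_conv a b x (A B : R) :
  (forall n, `|a n| <= 1) -> (forall n, `|b n| <= 1) -> `|x| < 1 ->
  pseries a x @ \oo --> A -> pseries b x @ \oo --> B ->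
  pseries (conv a b) x @ \oo --> A * B.
Proof.
move=> a1 b1 x1 aA bB.
apply: cvg_sub0 (cvgM aA bB); apply: norm_cvg0.
(* The error at N has N terms, each at most 2N |x|^N, and 2N^2 is at most 4(N+1)(N+2). *)
pose e n := 4 * (n.+1%:R * n.+2%:R * `|x| ^+ n).
apply: (@squeeze_cvgr _ _ _ _ (cst 0) e _).
- apply: nearW => N; rewrite normr_ge0 /=.
  pose p : {poly R} := \poly_(i < N) a i; pose q : {poly R} := \poly_(i < N) b i.
  have pE c : (\poly_(i < N) c i).[x] = pseries c x N.
    by rewrite horner_poly /pseries /series /= big_mkord.
  have szpq : (size (p * q)%R <= N + N)%N.
    apply: leq_trans (size_polyMleq _ _) _; apply: leq_trans (leq_pred _) _.
    by apply: leq_add; exact: size_poly.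
  have coefpq n : `|(p * q)`_n| <= n.+1%:R.
    rewrite coefM; apply: le_trans (ler_norm_sum _ _ _) _.
    have -> : n.+1%:R = \sum_(i < n.+1) (1 : R) by rewrite sumr_const card_ord.
    apply: ler_sum => i _; rewrite normrM !coef_poly.
    rewrite -[leRHS]mulr1; apply: ler_pM => //; case: ifP => _ //;
      by rewrite normr0.
  have -> : (pseries (conv a b) x - pseries a x * pseries b x) N =
      - \sum_(N <= n < N + N) (p * q)`_n * x ^+ n.
    rewrite !fctE -(pE a) -(pE b) -hornerM (horner_coef_wide _ szpq).
    rewrite -(big_mkord xpredT (fun n => (p * q)`_n * x ^+ n)).
    rewrite (big_cat_nat (leq0n N) (leq_addr N N))/=.
    rewrite opprD addrA [X in X - _](_ : _ = 0) ?sub0r//; apply/eqP.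
    rewrite subr_eq0; apply/eqP; apply: eq_big_nat => n /andP[_ nN].
    congr (_ * _); rewrite coefM; apply: eq_bigr => i _.
    rewrite !coef_poly (leq_ltn_trans _ nN) ?(leq_ltn_trans _ nN)//.
      exact: leq_subr.
    by rewrite -ltnS.
  rewrite normrN; apply: le_trans (ler_norm_sum _ _ _) _.
  apply: (@le_trans _ _ (\sum_(N <= n < N + N) (N + N)%:R * `|x| ^+ N)).
    apply: ler_sum_nat => n /andP[Nn nN]; rewrite normrM normrX.
    apply: ler_pM => //.
      by apply: le_trans (coefpq n) _; rewrite ler_nat.
    by apply: ler_wiXn2l => //; exact: ltW.
  rewrite sumr_const_nat addnK -[leLHS]mulr_natl mulrA /e mulrA.
  rewrite ler_wpM2r ?exprn_ge0// -!natrM ler_nat.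
  by nia.
- exact: cvg_cst.
- by rewrite -(mulr0 4); apply: cvgM; [exact: cvg_cst|exact: cvg_sqr_geometric].
Qed.

End power_series.

(** * Poisson mixtures *)

Section poisson_mixture.
Context {R : realType}.
Implicit Types (x y : R) (k n : nat).

(* Unlike [poisson_pmf], this is also the right weight at rate [x = 0]. *)
Definition poisson_weight x k : R := x ^+ k / k`!%:R * expR (- x).

Lemma poisson_pmfE x k : 0 < x -> poisson_pmf x k = poisson_weight x k.
Proof. by move=> x0; rewrite /poisson_pmf x0. Qed.

Lemma poisson_weight_ge0 x k : 0 <= x -> 0 <= poisson_weight x k.
Proof. by move=> x0; rewrite !mulr_ge0 ?exprn_ge0 ?invr_ge0 ?expR_ge0. Qed.

Lemma cvg_pseries_poisson_weight x y :
  pseries (poisson_weight x) y @ \oo --> expR (- ((1 - y) * x)).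
Proof.
have -> : expR (- ((1 - y) * x)) = expR (- x) *: expR (x * y).
  by rewrite -[RHS]expRD; congr expR; ring.
rewrite (_ : pseries _ _ = expR (- x) \*: series (exp_coeff (x * y))).
  by apply: cvgZl_tmp; exact: is_cvg_series_exp_coeff.
apply/funext => n; rewrite /pseries /series /=.
rewrite [RHS](_ : _ = \sum_(0 <= k < n) expR (- x) * exp_coeff (x * y) k);
  last by rewrite -mulr_sumr.
apply: eq_bigr => k _; rewrite /poisson_weight /exp_coeff /= exprMn; ring.
Qed.

(** Dominated by the partial sums at y = 1, which increase to the total mass 1. The bound is uniform
    in [x], as bounded convergence requires. *)
Lemma poisson_pseries_le1 x y n : 0 <= x -> `|y| <= 1 ->
  `|pseries (poisson_weight x) y n| <= 1.
Proof.
move=> x0 y1; pose p1 := pseries (poisson_weight x) 1.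
have p1_cvg : p1 @ \oo --> (1 : R).
  by have := @cvg_pseries_poisson_weight x 1; rewrite subrr mul0r oppr0 expR0.
apply: (@le_trans _ _ (p1 n)).
  apply: le_trans (ler_norm_sum _ _ _) _; apply: ler_sum => k _.
  rewrite /= normrM normrX expr1n mulr1 (ger0_norm (poisson_weight_ge0 _ x0)).
  by rewrite ler_piMr ?poisson_weight_ge0// exprn_ile1.
rewrite -(cvg_lim _ p1_cvg)//; apply: nondecreasing_cvgn_le; last first.
  by apply/cvg_ex; exists 1.
apply: nondecreasing_series => k _ _.
by rewrite mulr_ge0 ?poisson_weight_ge0 ?exprn_ge0.
Qed.

Lemma poisson_weight_le1 x k : 0 <= x -> poisson_weight x k <= 1.
Proof.
move=> x0; have h n : 0 <= pseries (poisson_weight x) 1 n <= 1.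
  have p0 : 0 <= pseries (poisson_weight x) 1 n.
    by apply: sumr_ge0 => i _; rewrite mulr_ge0 ?poisson_weight_ge0 ?exprn_ge0.
  by rewrite p0 -[leLHS]ger0_norm// poisson_pseries_le1 ?normr1.
have /andP[_] := h k.+1; rewrite /pseries /series /= big_nat_recr//= expr1n mulr1.
by apply: le_trans; rewrite lerDr; have /andP[] := h k.
Qed.

Lemma measurable_poisson_weight k :
  measurable_fun [set: R] (poisson_weight ^~ k).
Proof.
apply: measurable_funM; first exact: measurable_funM.
by apply: measurableT_comp => //; exact: measurableT_comp.
Qed.

Context {d : measure_display} {Omega : measurableType d}.
Variable P : probability Omega R.

Lemma integrable_norm_le1 (g : Omega -> R) : measurable_fun setT g ->
  (forall w, `|g w| <= 1) -> P.-integrable setT (EFin \o g).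
Proof.
move=> mg g1; apply: measurable_bounded_integrable => //.
  by rewrite (le_lt_trans (probability_le1 _ _)) ?ltry.
exists 1; split => // r r1 w _; exact: le_trans (g1 w) (ltW r1).
Qed.

Lemma bounded_convergence (g_ : nat -> Omega -> R) (g : Omega -> R) :
  (forall n, measurable_fun setT (g_ n)) -> measurable_fun setT g ->
  (forall w, g_ ^~ w @ \oo --> g w) -> (forall n w, `|g_ n w| <= 1) ->
  (\int[P]_w (g_ n w)%:E)%E @[n --> \oo] --> (\int[P]_w (g w)%:E)%E.
Proof.
move=> mg_ mg gg g1.
have cv : {ae P, forall w, [set: Omega] w -> (g_ n w)%:E @[n --> \oo] --> (g w)%:E}.
  by apply: aeW => w _; exact: cvg_EFin (nearW _ _) (gg w).
have bd : {ae P, forall w n, [set: Omega] w -> (`|(g_ n w)%:E| <= cst 1%:E w)%E}.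
  by apply: aeW => w n _; rewrite lee_fin.
by have [] := @dominated_convergence _ _ _ P _ measurableT _ _ _
  (fun n => (measurable_EFinP _ _).2 (mg_ n)) ((measurable_EFinP _ _).2 mg)
  cv (finite_measure_integrable_cst P 1 measurableT) bd.
Qed.

Variable X : Omega -> R.
Hypotheses (mX : measurable_fun setT X) (X0 : forall w, 0 <= X w).
Variable q : R^nat.
Hypothesis qE : forall k, (\int[P]_w (poisson_weight (X w) k)%:E)%E = (q k)%:E.

(** Integration commutes with the finite partial sums; these are bounded by 1, so the limit passes
    under the integral. *)
Lemma cvg_pseries_poisson_mixture y : `|y| < 1 ->
  (pseries q y n)%:E @[n --> \oo] --> (\int[P]_w (expR (- ((1 - y) * X w)))%:E)%E.
Proof.
move=> y1.
have mw k : measurable_fun setT (fun w => poisson_weight (X w) k).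
  exact: measurableT_comp (measurable_poisson_weight k) mX.
have iw k : P.-integrable setT (EFin \o (fun w => poisson_weight (X w) k)).
  apply: integrable_norm_le1 => // w.
  by rewrite ger0_norm ?poisson_weight_ge0 ?poisson_weight_le1.
have ek k w : (poisson_weight (X w) k * y ^+ k)%:E =
    ((y ^+ k)%:E * (poisson_weight (X w) k)%:E)%E by rewrite -EFinM mulrC.
have -> : (fun n => (pseries q y n)%:E) =
    (fun n => \int[P]_w (pseries (poisson_weight (X w)) y n)%:E)%E.
  apply/funext => n; rewrite /pseries /series /= -sumEFin.
  under [RHS]eq_integral do rewrite /= -sumEFin.
  rewrite integral_sum//; last first.
    by move=> k; under eq_fun do rewrite ek; exact: integrableZl (iw k).
  apply: eq_bigr => k _; under eq_integral do rewrite ek.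
  by rewrite (integralZl measurableT (iw k)) [X in (_ * X)%E](qE k) -EFinM mulrC.
apply: bounded_convergence.
- move=> n; apply: measurable_sum => k; apply: measurable_funM => //.
- apply: (measurableT_comp (@measurable_expR R)).
  by apply: (measurableT_comp (@oppr_measurable R setT)); exact: measurable_funM.
- by move=> w; exact: cvg_pseries_poisson_weight.
- by move=> n w; exact: poisson_pseries_le1 (X0 w) (ltW y1).
Qed.

End poisson_mixture.

(** * Exponential rates and the geometric law *)

Section exponential_rate.
Context {R : realType}.
Local Notation mu := (@lebesgue_measure R).

Section density.
Variables (nu : probability (measurableTypeR R) R) (g : R -> R).
Hypotheses
  (ig : mu.-integrable setT (EFin \o g))
  (nuE : forall A : set R, measurable A -> nu A = (\int[mu]_(x in A) (g x)%:E)%E).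

Lemma density_dominates : nu `<< mu.
Proof.
apply/null_content_dominatesP => A mA A0; rewrite nuE//.
apply: null_set_integral => //; apply: measurable_funTS.
exact: measurable_int ig.
Qed.

(** The Radon-Nikodym derivative gives the change of variables and agrees with [g] almost
    everywhere, as both have the same integral over every measurable set. *)
Lemma integral_density (f : R -> \bar R) : nu.-integrable setT f ->
  (\int[nu]_x f x = \int[mu]_x (f x * (g x)%:E))%E.
Proof.
move=> nuf.
rewrite -(Radon_Nikodym_change_of_variables density_dominates)//.
have mf : measurable_fun setT f by exact: measurable_int nuf.
have mg : measurable_fun setT (EFin \o g) by exact: measurable_int ig.
apply: ae_eq_integral => //.
- apply: emeasurable_funM => //; apply: (measurable_int mu).
  by apply: Radon_Nikodym_integrable; exact: density_dominates.
- exact: emeasurable_funM.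
- apply: ae_eqe_mul2l => /=; rewrite Radon_NikodymE//=.
    exact: density_dominates.
  move=> numu; case: cid => /= h [h1 h2 h3].
  apply: integral_ae_eq => //=.
  by move=> E E01 mE; rewrite -h3// nuE.
Qed.

End density.

Context {d : measure_display} {Omega : measurableType d}.
Variables (P : probability Omega R) (rate : R) (Lambda : {RV P >-> R}).
Hypotheses (rate_gt0 : 0 < rate)
  (LambdaE : forall A : set R, measurable A ->
     distribution P Lambda A = exponential_prob rate A).

Lemma exponential_rate_gt0 : {ae P, forall w, 0 < Lambda w}.
Proof.
exists (Lambda @^-1` `]-oo, 0]); split.
- exact: measurable_funPTI.
- have := LambdaE (measurable_itv `]-oo, 0]); rewrite /distribution /pushforward.
  move=> ->; rewrite /exponential_prob.
  (* The endpoint 0 is dropped as a null set: the density vanishes only at strictly negative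
     points. *)
  rewrite -integral_itv_bndo_bndc.
    by apply: integral0_eq => x; rewrite /= in_itv /= => x0; rewrite lt0_exponential_pdf.
  by apply: measurable_funTS; apply/measurable_EFinP; exact: measurable_exponential_pdf.
- by move=> w /= /negP; rewrite in_itv /= -leNgt.
Qed.

(* The library integrates against Lebesgue measure over [measurableTypeR R],
   whose measurable structure is not unifiable with the one carried by [R]. *)
Let Lambda' : Omega -> measurableTypeR R := Lambda.
Let measurable_Lambda' : measurable_fun setT Lambda'.
Proof.
by move=> mO A mA; have := @measurable_funPT _ _ _ _ Lambda mO A; exact.
Qed.
#[local] HB.instance Definition _ :=
  isMeasurableFun.Build _ _ _ _ Lambda' measurable_Lambda'.

(** On x >= 0, exp(-s x) times the density of rate [rate] is rate / (rate + s) times the density of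
    rate [rate + s], of mass 1. The maximum with 0 keeps the integrand bounded by 1 everywhere. *)
Lemma exponential_rate_laplace s : 0 <= s ->
  (\int[P]_w (expR (- (s * Num.max 0 (Lambda w))))%:E)%E = (rate / (rate + s))%:E.
Proof.
move=> s0; pose f x : R := expR (- (s * Num.max 0 x)).
have mf : measurable_fun setT (EFin \o f).
  apply/measurable_EFinP/(measurableT_comp (@measurable_expR R)).
  apply: (measurableT_comp (@oppr_measurable R setT)).
  by apply: measurable_funM => //; exact: measurable_maxr.
rewrite -[LHS](@ge0_integral_distribution _ _ _ _ _ P Lambda' (EFin \o f))//; last first.
  by move=> x; rewrite lee_fin expR_ge0.
rewrite (@integral_density (distribution P Lambda') (exponential_pdf rate)).
- have rs : 0 < rate + s by rewrite ltr_pwDl.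
  rewrite -[RHS]mule1 -(integral_exponential_pdf rs).
  rewrite -(integralZl measurableT (integrable_exponential_pdf rs)).
  apply: eq_integral => x _ /=; rewrite -!EFinM; congr EFin.
  have [x0|x0] := ltP x 0; first by rewrite !lt0_exponential_pdf// !mulr0.
  rewrite !exponential_pdfE// /f max_r// mulrCA -expRD.
  rewrite [RHS]mulrA divfK ?gt_eqF//; congr (_ * expR _); ring.
- exact: integrable_exponential_pdf rate_gt0.
- exact: LambdaE.
- apply: integrable_norm_le1; first exact/measurable_EFinP.
  move=> x; rewrite ger0_norm ?expR_ge0// -expR0 ler_expR oppr_le0.
  by rewrite mulr_ge0// le_max lexx.
Qed.

End exponential_rate.

(** * One-dimensional law of the geometric counting process *)

Section geometric_law.
Context {R : realType} {d : measure_display} {Omega : measurableType d}.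
Variable P : probability Omega R.

Lemma mixed_poisson_law (Lambda : {RV P >-> R}) (M : R -> {RV P >-> nat}) t m :
  mixed_poisson_process Lambda M -> 0 < t ->
  P [set w | M t w = m] = (\int[P]_w (poisson_pmf (Lambda w * t) m)%:E)%E.
Proof.
move=> [[M0 _ _] fdd] t0.
(* A single increment is used, from time 0 to [t]; the sequence i t only has to be increasing. *)
have := fdd setT 1%N (fun i => i%:R * t) (fun=> m) measurableT.
rewrite mul0r preimage_setT => /(_ (lexx _)); rewrite setTI.
have incr : increasing_seq (fun i : nat => i%:R * t).
  by move=> i j; rewrite ler_pM2r// ler_nat.
move=> /(_ incr); under eq_integral do rewrite big_ord1 mul1r mul0r subr0.
move=> <-; congr (P _); apply/seteqP; split=> w /=.
  by move=> Mw [|//] _ /=; rewrite mul1r mul0r M0 Mw.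
by move=> /(_ 0%N erefl) /=; rewrite mul1r mul0r M0 add0n.
Qed.

(** At t = 0 both sides are the point mass at 0. For t > 0 both generating functions equal 1 / (1 +
    mu t (1 - y)), and [pseries_inj] identifies the coefficients. *)
Lemma geometric_counting_law mu (M : R -> {RV P >-> nat}) t m :
  0 < mu -> geometric_counting_process mu M -> 0 <= t ->
  P [set w | M t w = m] = ((mu * t / (1 + mu * t)) ^+ m / (1 + mu * t))%:E.
Proof.
move=> mu0 [Lambda [LambdaE MP]]; rewrite le0r => /predU1P[->|t0].
  have [[M0 _ _] _] := MP.
  rewrite mulr0 addr0 mul0r divr1 expr0n; case: m => [|m] /=.
    rewrite (_ : [set _ | _] = setT) ?probability_setT//.
    by apply/seteqP; split=> w //=; rewrite M0.
  by rewrite (_ : [set _ | _] = set0) ?measure0// -subset0 => w /=; rewrite M0.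
have rate0 : 0 < mu^-1 by rewrite invr_gt0.
have mut : 0 < mu * t by rewrite mulr_gt0.
have mut1 : 0 < 1 + mu * t by rewrite addr_gt0.
set r := mu * t / (1 + mu * t).
have r01 : 0 <= r < 1.
  by rewrite divr_ge0 ?addr_ge0 ?ltW//= ltr_pdivrMr ?mul1r ?ltrDr ?addr_gt0.
(* Cutting [Lambda] at 0 changes it on a null set only and makes the mixing variable non-negative
   everywhere. *)
pose X w := t * Num.max 0 (Lambda w).
have X0 w : 0 <= X w by rewrite mulr_ge0 ?(ltW t0)// le_max lexx.
have mX : measurable_fun setT X.
  by apply: measurable_funM => //; exact: measurable_maxr.
pose p m := fine (P [set w | M t w = m]).
have mM k : measurable [set w | M t w = k].
  exact: (measurable_funPTI (M t) (Y := [set k])).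
have pE k : (\int[P]_w (poisson_weight (X w) k)%:E)%E = (p k)%:E.
  rewrite /p fineK ?fin_num_measure// (mixed_poisson_law _ MP)//.
  apply: ae_eq_integral => //.
  - apply/measurable_EFinP.
    exact: measurableT_comp (measurable_poisson_weight k) mX.
  - apply/measurable_EFinP.
    apply: (measurableT_comp (measurable_poisson_pmf k measurableT)).
    exact: measurable_funM.
  - apply: filterS (exponential_rate_gt0 LambdaE) => w L0 _ /=.
    by rewrite poisson_pmfE ?mulr_gt0// /X max_r ?ltW// mulrC.
have p1 k : `|p k| <= 1.
  rewrite ger0_norm ?fine_ge0// -[leRHS]/(fine 1%E) fine_le ?fin_num_measure//.
  exact: probability_le1.
suff pgeo : p = (fun k => r ^+ k / (1 + mu * t)).
  by rewrite -[RHS](congr1 (fun q : R^nat => (q m)%:E) pgeo) /p fineK ?fin_num_measure.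
apply: pseries_inj; [exact: bounded_subgeometric p1| |].
  apply: (@bounded_subgeometric _ _ (1 + mu * t)^-1) => k.
  have /andP[r0 r1] := r01; rewrite normrM normfV (gtr0_norm mut1) normrX.
  by rewrite (ger0_norm r0) ler_piMl ?invr_ge0 ?(ltW mut1)// exprn_ile1// ltW.
move=> y y1; have := cvg_pseries_poisson_mixture mX X0 pE y1.
have y0 : 0 <= 1 - y by rewrite subr_ge0 (le_trans (ler_norm _)) ?ltW.
under eq_integral do rewrite /X mulrA.
rewrite (exponential_rate_laplace rate0 LambdaE) ?mulr_ge0 ?(ltW t0)//.
move=> /fine_cvg/cvg_lim -> //; apply/esym/cvg_lim => //.
rewrite (_ : pseries _ _ = series (geometric (1 + mu * t)^-1 (r * y))); last first.
  apply/funext => n; apply: eq_bigr => k _ /=.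
  by rewrite [(r * y) ^+ k]exprMn mulrAC mulrC.
have ry : `|r * y| < 1.
  have /andP[r0 r1] := r01; rewrite normrM (ger0_norm r0).
  by rewrite -[ltRHS]mul1r; apply: ltr_pM.
have -> : mu^-1 / (mu^-1 + (1 - y) * t) =
          (1 + mu * t)^-1 / (1 - r * y).
  have y2 : 0 < 1 + mu * t * (1 - y).
    by rewrite ltr_pwDl// mulr_ge0 ?(ltW mut).
  rewrite /r; field; rewrite (gt_eqF mu0) (gt_eqF mut1) andbT /=.
  by rewrite -addrA -[X in _ + (X - _)]mulr1 -mulrBr gt_eqF.
exact: cvg_geometric_series.
Qed.

End geometric_law.

(** * A counting process at an independent random time *)

Section independent_time.
Context {R : realType} {d : measure_display} {Omega : measurableType d}.
Variable P : probability Omega R.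
Variables (tau : {RV P >-> R}) (N : R -> {RV P >-> nat}).
Hypothesis tau0 : forall w, 0 <= tau w.

Let grid (n i : nat) : R := i%:R / n.+1%:R.
Let cell (n i : nat) : set R := `[grid n i, grid n i.+1[%classic.

(* Approximates [tau] strictly from above, so that right continuity applies. *)
Let upper n w : R := grid n (Num.trunc (n.+1%:R * tau w)).+1.

Let in_cellE n i w : cell n i (tau w) <-> Num.trunc (n.+1%:R * tau w) = i.
Proof.
have n0 : 0 < n.+1%:R :> R by [].
rewrite /cell /= in_itv /= /grid ler_pdivrMr// ltr_pdivlMr// ![tau w * _]mulrC.
split=> [|<-]; first exact: truncn_def.
by apply: truncn_itv; rewrite mulr_ge0.
Qed.

Let bigcup_cell n : \bigcup_i (tau @^-1` cell n i) = setT.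
Proof.
by rewrite -subTset => w _; exists (Num.trunc (n.+1%:R * tau w)) => //; apply/in_cellE.
Qed.

Let trivIset_cell n : trivIset setT (fun i => tau @^-1` cell n i).
Proof.
apply/trivIsetP => i j _ _ /eqP ij; rewrite -subset0 => w /= [/in_cellE wi /in_cellE wj].
by apply: ij; rewrite -wi -wj.
Qed.

Let measurable_cell n i : measurable (tau @^-1` cell n i).
Proof. by apply: measurable_funPTI; exact: measurable_itv. Qed.

Let upper_gt n w : tau w < upper n w.
Proof. by rewrite /upper /grid ltr_pdivlMr// mulrC truncnS_gt. Qed.

Let cvg_upper w : upper n w @[n --> \oo] --> tau w.
Proof.
apply: (@squeeze_cvgr _ _ _ _ (cst (tau w)) (fun n => tau w + n.+1%:R^-1)).
- apply: nearW => n; rewrite /cst ltW//= /upper /grid ler_pdivrMr//.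
  rewrite mulrDl mulVf// -natr1 lerD2r mulrC truncn_le mulr_ge0//.
- exact: cvg_cst.
- rewrite -[X in _ --> X]addr0; apply: cvgD; first exact: cvg_cst.
  exact: cvg_harmonic.
Qed.

Variables F G : set (set Omega).
Hypotheses (FG : independent_pair P F G)
  (Ftau : forall A : set R, measurable A -> F (tau @^-1` A))
  (GN : forall t k, 0 <= t -> G [set w | N t w = k]).
Hypothesis N_rc : forall w t, 0 <= t -> N s w @[s --> t^'+] --> N t w.

Let measurableN t k : measurable [set w | N t w = k].
Proof. exact: (measurable_funPTI (N t) (Y := [set k])). Qed.

(** On a cell the random time is a fixed grid point, so independence applies piece by piece. *)
Let upper_event n k : [set w | N (upper n w) w = k] =
  \bigcup_i ((tau @^-1` cell n i) `&` [set w | N (grid n i.+1) w = k]).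
Proof.
apply/seteqP; split=> w /=.
  by move=> Nk; exists (Num.trunc (n.+1%:R * tau w)) => //; split=> //; apply/in_cellE.
by move=> [i _ [/in_cellE]]; rewrite /upper => ->.
Qed.

Let measurable_upper_event n k : measurable [set w | N (upper n w) w = k].
Proof.
by rewrite upper_event; apply: bigcup_measurable => i _; exact: measurableI.
Qed.

(** The values are discrete, so right continuity makes [N] constant just after [tau w], where
    [upper n w] eventually lies. *)
Let near_upper_event w k :
  \forall n \near \oo, \1_[set w | N (upper n w) w = k] w =
                       \1_[set w | N (tau w) w = k] w :> R.
Proof.
have atr : \forall s \near tau w, tau w < s -> N s w = N (tau w) w.
  by have := @N_rc w _ (tau0 w) [set N (tau w) w]; apply; exact: discrete_set1.
have near_N : \forall n \near \oo, tau w < upper n w -> N (upper n w) w = N (tau w) w.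
  exact: cvg_upper w _ atr.
apply: filterS near_N => n /(_ (upper_gt n w)) Nn.
by rewrite !indicE; congr (_%:R); congr nat_of_bool; apply/idP/idP; rewrite !inE /= Nn.
Qed.

(** The identity holds at each [upper n] by summing over cells, and both sides converge by bounded
    convergence. Since [upper n] is positive, the law of [N] enters at positive times only; right
    continuity of [p] covers tau = 0. *)
Lemma independent_time_law (p : R -> R) k : measurable_fun setT p ->
  (forall t, 0 <= t -> p s @[s --> t^'+] --> p t) ->
  (forall t, 0 < t -> P [set w | N t w = k] = (p t)%:E) ->
  P [set w | N (tau w) w = k] = (\int[P]_w (p (tau w))%:E)%E.
Proof.
move=> mp p_rc pE.
have p01 t : 0 < t -> 0 <= p t <= 1.
  by move=> t0; rewrite -!lee_fin -(pE t t0) measure_ge0 probability_le1.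
have s0 n i : 0 < grid n i.+1 by rewrite divr_gt0.
have up0 n w : 0 < upper n w := le_lt_trans (tau0 w) (upper_gt n w).
have ind_cvg w : \1_[set w | N (upper n w) w = k] w @[n --> \oo] -->
    (\1_[set w | N (tau w) w = k] w : R).
  exact: cvg_near_cst (near_upper_event w k).
(* Measurable as a pointwise limit of measurable indicators; no joint measurability of [N] is
   invoked. *)
have mind : measurable_fun setT (\1_[set w | N (tau w) w = k] : Omega -> R).
  apply: (measurable_fun_cvg (h := fun n => \1_[set w | N (upper n w) w = k])) => //.
have mtau : measurable [set w | N (tau w) w = k] by exact/(measurable_indicP R).
have mup n : measurable_fun setT (upper n).
  rewrite -(bigcup_cell n); apply/measurable_fun_bigcup => // i.
  apply: (eq_measurable_fun (cst (grid n i.+1))) => // w.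
  by rewrite inE => /in_cellE <-.
have stepE n : P [set w | N (upper n w) w = k] = (\int[P]_w (p (upper n w))%:E)%E.
  rewrite upper_event measure_bigcup//; last 2 first.
  - by move=> i _; exact: measurableI.
  - exact/trivIset_setIr/trivIset_cell.
  rewrite -(bigcup_cell n) ge0_integral_bigcup ?bigcup_cell//; last 2 first.
  - apply/measurable_EFinP; exact: measurableT_comp.
  - by move=> w _; rewrite lee_fin (andP (p01 _ (up0 n w))).1.
  rewrite (@eq_eseriesl _ _ xpredT); last by move=> i; rewrite in_setT.
  apply: eq_eseriesr => i _.
  transitivity (P (tau @^-1` cell n i) * P [set w | N (grid n i.+1) w = k])%E.
    by apply: FG; [apply: Ftau; exact: measurable_itv|exact/GN/ltW].
  rewrite pE// muleC -integral_cst//; apply: eq_integral => w.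
  by rewrite inE => /in_cellE <-.
have indE A : measurable A -> (\int[P]_w (\1_A w)%:E)%E = P A.
  by move=> mA; rewrite integral_indic// setIT.
have lhs : P [set w | N (upper n w) w = k] @[n --> \oo] --> P [set w | N (tau w) w = k].
  rewrite -(indE _ mtau); under eq_fun do rewrite -(indE _ (measurable_upper_event _ k)).
  apply: bounded_convergence => //; first by move=> n; exact: measurable_indic.
  by move=> n w; rewrite ger0_norm ?indic_ge0 ?indic_le1.
have rhs : P [set w | N (upper n w) w = k] @[n --> \oo] --> (\int[P]_w (p (tau w))%:E)%E.
  under eq_fun do rewrite stepE.
  apply: bounded_convergence.
  - by move=> n; exact: measurableT_comp.
  - exact: measurableT_comp.
  - move=> w; have /cvg_at_rightP := p_rc (tau w) (tau0 w); apply.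
    by split => // n.
  - by move=> n w; have /andP[p0 p1] := p01 _ (up0 n w); rewrite ger0_norm.
exact: cvg_unique lhs rhs.
Qed.

End independent_time.

(** * Sums of a random number of independent variables *)

Definition partial_sum {T : Type} (W : nat -> T -> nat) (m : nat) (w : T) : nat :=
  (\sum_(i < m) W i w)%N.

(** The iteration starts from the point mass at 0, the unit of convolution. *)
Definition conv_pow {R : realType} (q : R^nat) (m : nat) : R^nat :=
  iter m (conv q) (fun n => (n == 0%N)%:R).

Section compound_law.
Context {R : realType} {d : measure_display} {Omega : measurableType d}.
Variable P : probability Omega R.

Lemma independent_preimages {I : eqType} (W : I -> {RV P >-> nat})
    (J : seq I) (A : I -> set nat) :
  independent_RVs P W -> uniq J ->
  P (\bigcap_(i in [set` J]) (W i @^-1` A i)) = (\prod_(i <- J) P (W i @^-1` A i))%E.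
Proof.
move=> indep uJ; apply: (indep J (fun i => W i @^-1` A i) uJ) => i _.
by exists (A i) => //; rewrite setTI.
Qed.

Variables (W : nat -> {RV P >-> nat}) (q : R^nat).
Hypotheses (indepW : independent_RVs P W)
  (Wlaw : forall i k, P [set w | W i w = k] = (q k)%:E).

Let measurableW i k : measurable [set w | W i w = k].
Proof. exact: (measurable_funPTI (W i) (Y := [set k])). Qed.

Lemma partial_sum0 n :
  [set w | partial_sum W 0 w = n] = if n == 0%N then setT else set0.
Proof.
rewrite /partial_sum; case: eqP => [->|n0]; apply/seteqP; split=> w //=.
  by rewrite big_ord0.
by rewrite big_ord0 => /esym.
Qed.

(** Splits by the value [j] of the last summand; [j] at most [n] keeps the natural subtraction
    exact. *)
Lemma partial_sumS m n : [set w | partial_sum W m.+1 w = n] =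
  \big[setU/set0]_(j < n.+1)
    ([set w | partial_sum W m w = (n - j)%N] `&` [set w | W m w = j]).
Proof.
rewrite -(bigcup_mkord n.+1 (fun j => [set w | partial_sum W m w = (n - j)%N]
  `&` [set w | W m w = j])); apply/seteqP; split=> w /=.
  rewrite /partial_sum big_ord_recr /= => <-.
  by exists (W m w); rewrite /= ?ltnS ?leq_addl//; split => //; rewrite addnK.
move=> [j /=]; rewrite ltnS => jn [Sm Wm].
by rewrite /partial_sum big_ord_recr /= [X in (X + _)%N]Sm Wm subnK.
Qed.

Lemma measurable_partial_sum m n : measurable [set w | partial_sum W m w = n].
Proof.
elim: m n => [|m IH] n; first by rewrite partial_sum0; case: ifP.
by rewrite partial_sumS; apply: bigsetU_measurable => j _; exact: measurableI.
Qed.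

(* Intersecting with a cylinder over later indices is what makes the induction
   on [m] work. *)
Let law_partial_sum_cap m n (J : seq nat) (A : nat -> set nat) :
  uniq J -> {in J, forall i, (m <= i)%N} ->
  P ([set w | partial_sum W m w = n] `&` \bigcap_(i in [set` J]) (W i @^-1` A i)) =
  ((conv_pow q m n)%:E * P (\bigcap_(i in [set` J]) (W i @^-1` A i)))%E.
Proof.
elim: m n J A => [|m IH] n J A uJ mJ.
  rewrite partial_sum0 /conv_pow /=; case: eqP => _; first by rewrite setTI mul1e.
  by rewrite set0I measure0 mul0e.
pose E := \bigcap_(i in [set` J]) (W i @^-1` A i).
have mE : measurable E by
  apply: fin_bigcap_measurable => // i _; exact: measurable_funPTI.
have mNJ : m \notin J by apply/negP => /mJ; rewrite ltnn.
(* The event that [W m] equals [j] joins the cylinder as a new coordinate, so that the induction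
   hypothesis applies to [m :: J]. *)
pose B j i := if i == m then [set j] else A i.
have capB j : [set w | W m w = j] `&` E = \bigcap_(i in [set` m :: J]) (W i @^-1` B j i).
  apply/seteqP; split=> w /=.
    move=> [Wm Ew] i /=; rewrite in_cons /B => /predU1P[->|iJ].
      by rewrite eqxx.
    by case: eqP => [im|_]; [rewrite im in iJ; rewrite iJ in mNJ|exact: Ew].
  move=> Bw; split; first by have := Bw m; rewrite /= mem_head /B eqxx; apply.
  move=> i /= iJ; have := Bw i; rewrite /= in_cons iJ orbT /B => /(_ isT).
  by case: eqP => [im|//]; rewrite im in iJ; rewrite iJ in mNJ.
have PB j : P ([set w | W m w = j] `&` E) = ((q j)%:E * P E)%E.
  rewrite capB independent_preimages//=; last by rewrite mNJ.
  rewrite big_cons {1}/B eqxx -(Wlaw m j); congr (_ * _)%E.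
  rewrite [RHS]independent_preimages//; apply: eq_big_seq => i iJ.
  by rewrite /B; case: eqP => // im; rewrite im in iJ; rewrite iJ in mNJ.
have powS : conv_pow q m.+1 n = \sum_(j < n.+1) q j * conv_pow q m (n - j)%N by [].
rewrite powS -/E partial_sumS big_distrl.
pose F j := ([set w | partial_sum W m w = (n - j)%N] `&` [set w | W m w = j]) `&` E.
rewrite (measure_bigsetU P (F := F)); last 2 first.
- move=> j; rewrite /F; do 2 apply: measurableI => //; exact: measurable_partial_sum.
- apply/trivIsetP => i j _ _ /eqP ij; rewrite -subset0 => w [[[_ /= wi] _] [[_ /= wj] _]].
  by apply: ij; rewrite -wi -wj.
have PEK : (fine (P E))%:E = P E by rewrite fineK ?fin_num_measure.
rewrite -PEK -EFinM mulr_suml -sumEFin.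
apply: eq_bigr => j _; rewrite /F -setIA capB.
transitivity ((conv_pow q m (n - j)%N)%:E *
    P (\bigcap_(i in [set` m :: J]) (W i @^-1` B j i)))%E.
  apply: IH => /=; first by rewrite mNJ.
  by move=> i; rewrite in_cons => /predU1P[->//|/mJ/ltnW].
by rewrite -capB PB -PEK -!EFinM mulrA [_ * q j]mulrC.
Qed.

Lemma law_partial_sum m n : P [set w | partial_sum W m w = n] = (conv_pow q m n)%:E.
Proof.
have := law_partial_sum_cap n (m := m) (J := [::]) (fun=> setT) isT.
rewrite (_ : [set` [::]] = set0) ?bigcap_set0 ?setIT ?probability_setT ?mule1;
  first exact.
by apply/seteqP; split.
Qed.

(** Needed to apply the independence of [M] and the whole sequence [W] to partial sums. *)
Lemma sigma_partial_sum m n :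
  process_sigma setT W [set w | partial_sum W m w = n].
Proof.
rewrite /process_sigma; set C := \bigcup_(i in _) _.
have mW i k : measurable ([set w | W i w = k] : set (g_sigma_algebraType C)).
  apply: sub_sigma_algebra; exists i => //.
  by exists [set k] => //; rewrite setTI.
suff : measurable ([set w | partial_sum W m w = n] : set (g_sigma_algebraType C)) by [].
elim: m n => [|m IH] n; first by rewrite partial_sum0; case: ifP.
by rewrite partial_sumS; apply: bigsetU_measurable => j _; exact: measurableI.
Qed.

Variables (M : R -> {RV P >-> nat}) (t : R) (p : R^nat).
Hypotheses (t0 : 0 <= t) (Mlaw : forall m, P [set w | M t w = m] = (p m)%:E)
  (MW : independent_pair P (process_sigma nonneg_times M) (process_sigma setT W)).

Let measurableM m : measurable [set w | M t w = m].
Proof. exact: (measurable_funPTI (M t) (Y := [set m])). Qed.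

Lemma total_damage_event n : [set w | total_damage M W t w = n] =
  \bigcup_m ([set w | M t w = m] `&` [set w | partial_sum W m w = n]).
Proof.
apply/seteqP; split=> w /=; first by exists (M t w).
by move=> [m _ [<-]].
Qed.

Lemma measurable_total_damage n : measurable [set w | total_damage M W t w = n].
Proof.
rewrite total_damage_event; apply: bigcup_measurable => m _.
by apply: measurableI => //; exact: measurable_partial_sum.
Qed.

(** On the event of [m] shocks the damage is the [m]-th partial sum, and independence factors the
    probability. *)
Lemma total_damage_law n : P [set w | total_damage M W t w = n] =
  (\sum_(0 <= m <oo) (p m * conv_pow q m n)%:E)%E.
Proof.
rewrite total_damage_event measure_bigcup; last 2 first.
- by move=> m _; apply: measurableI => //; exact: measurable_partial_sum.
- by apply/trivIsetP => i j _ _ /eqP ij; rewrite -subset0 => w [[/= wi _] [/= wj _]];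
    apply: ij; rewrite -wi -wj.
rewrite (@eq_eseriesl _ _ xpredT); last by move=> i; rewrite in_setT.
apply: eq_eseriesr => m _; rewrite EFinM -Mlaw -law_partial_sum.
apply: MW; last exact: sigma_partial_sum.
by apply: sub_sigma_algebra; exists t => //; exists [set m] => //; rewrite setTI.
Qed.

End compound_law.

(** * Renewal equation and generating function of a geometric compound sum *)

Section geometric_compound.
Context {R : realType}.
Variables (p q z : R^nat) (r : R).
Hypotheses (p0 : forall m, 0 <= p m) (q0 : forall m, 0 <= q m) (r0 : 0 <= r)
  (pS : forall m, p m.+1 = r * p m)
  (zE : forall n, (z n)%:E = (\sum_(0 <= m <oo) (p m * conv_pow q m n)%:E)%E).

Lemma conv_pow_ge0 m n : 0 <= conv_pow q m n.
Proof.
elim: m n => [|m IH] n; first exact: ler0n.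
by apply: sumr_ge0 => i _; exact: mulr_ge0.
Qed.

(* Renewal equation: condition on the first shock. *)
Lemma geometric_compound_renewal n :
  z n = p 0%N * (n == 0%N)%:R + r * conv q z n.
Proof.
have term0 m k : (0 <= (p m * conv_pow q m k)%:E)%E.
  by rewrite lee_fin mulr_ge0 ?conv_pow_ge0.
(* The term m = 0 is the point mass; the others are shifted by one, and non-negativity permits
   exchanging the series with the convolution sum. *)
apply: EFin_inj; rewrite zE nneseries_recl// EFinD; congr (_ + _)%E.
rewrite -(nneseries_addn 1)//=.
rewrite /conv mulr_sumr -sumEFin.
under eq_bigr do rewrite mulrA EFinM zE.
under eq_bigr do rewrite -nneseriesZl//.
rewrite -nneseries_sum//; last first.
  by move=> i m _; rewrite mule_ge0// lee_fin mulr_ge0.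
apply: eq_eseriesr => m _; rewrite addn1 pS -mulrA EFinM.
rewrite (_ : conv_pow q m.+1 n = \sum_(j < n.+1) q j * conv_pow q m (n - j)%N)//.
rewrite !mulr_sumr -EFinM mulr_sumr -sumEFin; apply: eq_bigr => i _.
by rewrite -EFinM; congr EFin; ring.
Qed.

Hypotheses (q1 : forall n, `|q n| <= 1) (z1 : forall n, `|z n| <= 1).

(** Passing to power series turns the renewal equation into Z = p_0 + r Q Z, which is solved for
    Z. *)
Lemma geometric_compound_pseries x Q : `|x| < 1 -> r * Q < 1 ->
  pseries q x @ \oo --> Q -> pseries z x @ \oo --> p 0%N / (1 - r * Q).
Proof.
move=> x1 rQ qQ.
have z_cvg : cvgn (pseries z x).
  exact: is_cvg_pseries_subgeometric (bounded_subgeometric z1) x1.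
set Z := limn (pseries z x).
have convE : pseries (conv q z) x @ \oo --> Q * Z by exact: cvg_pseries_conv.
have ZE : pseries z x @ \oo --> p 0%N + r * (Q * Z).
  rewrite -(cvg_shiftS (pseries z x)).
  have -> : (fun n => pseries z x n.+1) =
      (fun n => p 0%N + r * pseries (conv q z) x n.+1).
    apply/funext => n; rewrite /pseries /series /= mulr_sumr.
    rewrite big_nat_recl// [in RHS]big_nat_recl// expr0 !mulr1.
    rewrite geometric_compound_renewal eqxx mulr1 -addrA; congr (_ + (_ + _)).
    by apply: eq_bigr => i _; rewrite geometric_compound_renewal mulr0 add0r mulrA.
  apply: cvgD; first exact: cvg_cst.
  apply: cvgM; first exact: cvg_cst.
  by rewrite (cvg_shiftS (pseries (conv q z) x)).
have ZZ : Z = p 0%N + r * (Q * Z) by exact: cvg_lim ZE.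
have -> : p 0%N = Z * (1 - r * Q) by rewrite mulrBr mulr1 [X in X - _]ZZ; ring.
by rewrite mulfK// subr_eq0 gt_eqF.
Qed.

End geometric_compound.

(** * The cumulative shock model *)

Section subordinated_poisson.
Context {R : realType} {d : measure_display} {Omega : measurableType d}.
Variable P : probability Omega R.
Variables (D : R -> {RV P >-> R}) (f : R -> R) (N : R -> {RV P >-> nat}).
Variable lambda : R.
Hypotheses (hD : levy_subordinator D) (hDf : has_laplace_exponent D f)
  (lambda0 : 0 < lambda) (hN : poisson_process lambda N)
  (hDN : independent_pair P (process_sigma nonneg_times D)
                            (process_sigma nonneg_times N)).

Lemma subordinator_ge0 w t : 0 <= t -> 0 <= D t w.
Proof.
by have [[D0 _ _ _ _] Dmono] := hD => t0; rewrite -(D0 w); exact: Dmono.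
Qed.

Lemma continuous_poisson_weight k : continuous (poisson_weight ^~ k : R -> R).
Proof.
move=> x; rewrite /poisson_weight; apply: cvgM.
  by apply: cvgM; [exact: exprn_continuous|exact: cvg_cst].
apply: continuous_comp; last exact: continuous_expR.
exact: continuousN.
Qed.

(** [independent_time_law] at the time [D 1]. Using [poisson_weight] gives a continuous function of
    time with the right value even where [D 1] vanishes. *)
Lemma subordinate_law k :
  P [set w | subordinate N D 1 w = k] =
  (\int[P]_w (poisson_weight (lambda * D 1 w) k)%:E)%E.
Proof.
have [[N0 _ Nrc] _ Npmf] := hN.
have D1_ge0 w : 0 <= D 1 w by exact: subordinator_ge0.
have sigmaD (A : set R) : measurable A -> process_sigma nonneg_times D (D 1 @^-1` A).
  move=> mA; apply: sub_sigma_algebra; exists 1; first exact: ler01.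
  by exists A => //; rewrite setTI.
have sigmaN t j : 0 <= t -> process_sigma nonneg_times N [set w | N t w = j].
  move=> t0; apply: sub_sigma_algebra; exists t => //.
  by exists [set j] => //; rewrite setTI.
apply: (independent_time_law D1_ge0 hDN sigmaD sigmaN Nrc
  (p := fun s => poisson_weight (lambda * s) k)).
- by apply: (measurableT_comp (measurable_poisson_weight k)); exact: measurable_funM.
- move=> t _; apply: cvg_at_right_filter.
  apply: (@continuous_comp _ _ _ ( *%R lambda) (poisson_weight ^~ k)).
    exact: mulrl_continuous.
  exact: continuous_poisson_weight.
- move=> t t0; have := Npmf 0 t k (lexx _) t0.
  rewrite subr0 poisson_pmfE ?mulr_gt0// => <-; congr (P _).
  by apply/seteqP; split=> w /=; rewrite N0.
Qed.

(** The mixture's generating function at 1 - u is the Laplace transform of [D 1] at [lambda * u],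
    which is non-negative on this disc. *)
Lemma subordinate_pseries (q : R^nat) u :
  (forall k, P [set w | subordinate N D 1 w = k] = (q k)%:E) ->
  `|1 - u| < 1 -> pseries q (1 - u) @ \oo --> expR (- f (lambda * u)).
Proof.
move=> qE u1.
have u0 : 0 <= u by move: u1; rewrite ltr_norml => /andP[_]; lra.
have -> : expR (- f (lambda * u)) =
    fine (\int[P]_w (expR (- ((1 - (1 - u)) * (lambda * D 1 w))))%:E)%E.
  have := hDf (mulr_ge0 (ltW lambda0) u0) ler01.
  rewrite unlock mulN1r => DE; rewrite -[LHS]/(fine (_%:E)) -DE.
  congr fine; apply: eq_integral => w _; congr ((expR _)%:E); ring.
have mX : measurable_fun setT (fun w => lambda * D 1 w) by exact: measurable_funM.
have X0 w : 0 <= lambda * D 1 w by rewrite mulr_ge0 ?(ltW lambda0)// subordinator_ge0.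
set L := (\int[P]_w _)%E.
have L_fin : L \is a fin_num.
  apply: integrable_fin_num => //; apply: integrable_norm_le1.
    apply: (measurableT_comp (@measurable_expR R)).
    by apply: (measurableT_comp (@oppr_measurable R setT)); exact: measurable_funM.
  move=> w; rewrite ger0_norm ?expR_ge0// -[leRHS]expR0 ler_expR oppr_le0.
  by rewrite mulr_ge0// opprB addrC subrK.
apply: (fine_cvg (f := fun n => (pseries q (1 - u) n)%:E)).
rewrite fineK//; apply: cvg_pseries_poisson_mixture => // k.
by rewrite -qE subordinate_law.
Qed.

End subordinated_poisson.

Theorem theorem4 (R : realType)
  (* the subordinated Poisson process N^f, on its own probability space *)
  (d' : measure_display) (Omega' : measurableType d')
  (P' : probability Omega' R)
  (b : R) (nu : {measure set R -> \bar R}) (f : R -> R)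
  (hf : bernstein_function b nu f)
  (hnu : nu `]0%R, +oo[%classic = +oo%E)
  (D : R -> {RV P' >-> R}) (hD : levy_subordinator D)
  (hDf : has_laplace_exponent D f)
  (lambda : R) (hlambda : 0 < lambda)
  (N : R -> {RV P' >-> nat}) (hN : poisson_process lambda N)
  (hDN : independent_pair P' (process_sigma nonneg_times D)
                             (process_sigma nonneg_times N))
  (* the shock model *)
  (d : measure_display) (Omega : measurableType d) (P : probability Omega R)
  (mu : R) (hmu : 0 < mu)
  (M : R -> {RV P >-> nat}) (hM : geometric_counting_process mu M)
  (W : nat -> {RV P >-> nat}) (hWindep : independent_RVs P W)
  (hWlaw : forall i, same_law P (W i) P' (subordinate N D 1))
  (hMW : independent_pair P (process_sigma nonneg_times M)
                            (process_sigma setT W))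
  (T : nat) (hT : (0 < T)%N)
  (S : Omega -> \bar R) (hS : cumulative_shock_lifetime M W T S)
  (t : R) (ht : 0 <= t) :
  P [set w | (t%:E < S w)%E] =
  (\sum_(k < T) (-1) ^+ k / k`!%:R *
     derive1n k
       (fun u : R => 1 / (1 + mu * t * (1 - expR (- f (lambda * u))))) 1)%:E.
Proof.
have fine_law A : measurable A -> (fine (P A))%:E = P A.
  by move=> mA; rewrite fineK ?fin_num_measure.
have norm_fine_law A : measurable A -> `|fine (P A)| <= 1.
  move=> mA; rewrite ger0_norm ?fine_ge0// -[leRHS]/(fine 1%E).
  by rewrite fine_le ?fin_num_measure//; exact: probability_le1.
have mW i k : measurable [set w | W i w = k].
  exact: (measurable_funPTI (W i) (Y := [set k])).
pose q k := fine (P [set w | W 0%N w = k]).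
(* Equality in law carries the weights [q] from the damages to N^f(1) on its own space. *)
have q'E k : P' [set w | subordinate N D 1 w = k] = (q k)%:E.
  by rewrite fine_law//; apply/esym/(hWlaw 0%N [set k]).
have qE i k : P [set w | W i w = k] = (q k)%:E.
  by rewrite -q'E; exact: (hWlaw i [set k]).
have q0 k : 0 <= q k by exact: fine_ge0.
have mut : 0 <= mu * t by rewrite mulr_ge0// ltW.
have mut1 : 0 < 1 + mu * t by rewrite ltr_pwDl.
set r := mu * t / (1 + mu * t).
have r0 : 0 <= r by rewrite divr_ge0// ltW.
pose p m : R := r ^+ m / (1 + mu * t).
pose z n := fine (P [set w | total_damage M W t w = n]).
have mZ n := measurable_total_damage W M t n.
have zE n : (z n)%:E = (\sum_(0 <= m <oo) (p m * conv_pow q m n)%:E)%E.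
  rewrite fine_law//; apply: total_damage_law => // m.
  exact: geometric_counting_law.
have z1 n : `|z n| <= 1 by exact: norm_fine_law.
(* The function of [u] is the generating function of [z] at 1 - u. *)
have coefE k : derive1n k
    (fun u : R => 1 / (1 + mu * t * (1 - expR (- f (lambda * u))))) 1 =
    (-1) ^+ k * k`!%:R * z k.
  apply: derive1n_pseries_coef; first exact: bounded_subgeometric z1.
  move=> u u1; set phi := expR _.
  (* The Bernstein representation makes [f] non-negative; as r < 1, this keeps 1 - r phi
     positive. *)
  have phi1 : phi <= 1.
    have lu0 : 0 <= lambda * u.
      rewrite mulr_ge0 ?(ltW hlambda)//.
      by move: u1; rewrite ltr_norml => /andP[_]; lra.
    rewrite -[leRHS]expR0 ler_expR oppr_le0; have [b0 _ ->//] := hf.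
    apply: addr_ge0; first exact: mulr_ge0.
    apply: Rintegral_ge0 => x /=.
    rewrite in_itv /= andbT => x0; rewrite subr_ge0 -[leRHS]expR0 ler_expR.
    by rewrite mulNr oppr_le0 mulr_ge0// ltW.
  have rphi1 : r * phi < 1.
    apply: (@le_lt_trans _ _ r); first by rewrite ler_piMr.
    by rewrite ltr_pdivrMr// mul1r ltrDr.
  have -> : 1 / (1 + mu * t * (1 - phi)) = p 0%N / (1 - r * phi).
    rewrite /p expr0 /r; field; rewrite (gt_eqF mut1) /=.
    have : 0 < 1 + mu * t * (1 - phi).
      by rewrite ltr_pwDl// mulr_ge0// subr_ge0.
    by move=> /gt_eqF; rewrite mulrBr mulr1 addrA => ->.
  apply: (@geometric_compound_pseries _ p q z r) => //.
  - by move=> m; rewrite /p divr_ge0 ?exprn_ge0// ltW.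
  - by move=> m; rewrite /p exprS mulrA.
  - by move=> n; exact: norm_fine_law.
  - exact: (subordinate_pseries hD hDf hlambda hN hDN q'E u1).
(* Survival past [t] means that the damage takes one of the values 0 to T - 1. *)
have -> : [set w | (t%:E < S w)%E] =
    \big[setU/set0]_(k < T) [set w | total_damage M W t w = k].
  rewrite -(bigcup_mkord T (fun k => [set w | total_damage M W t w = k])).
  apply/seteqP; split=> w /=.
    by move=> /(hS w t ht) ZT; exists (total_damage M W t w).
  by move=> [k /= kT Zk]; apply/(hS w t ht); rewrite Zk.
rewrite (measure_bigsetU P (F := fun k => [set w | total_damage M W t w = k]))//;
  last first.
  apply/trivIsetP => i j _ _ /eqP ij; rewrite -subset0 => w [/= wi wj].
  by apply: ij; rewrite -wi -wj.
rewrite -sumEFin; apply: eq_bigr => k _.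
transitivity (z k)%:E; first exact/esym/fine_law.
congr EFin.
have k0 : k`!%:R != 0 :> R by rewrite pnatr_eq0 -lt0n fact_gt0.
(* The two signs multiply to 1 and the factorials cancel. *)
by rewrite coefE mulrA mulrACA -expr2 sqrr_sign mul1r mulVf ?mul1r.
Qed.
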